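(* Let $q\ge 2$ and let $A$ be an alphabet with $q$ letters. There is a constant $c>1$ such that for every rich word $w$ over $A$ of length $n\ge 2$, the number $p$ of palindromes in the UPS-factorization $w=w_pw_{p-1}\cdots w_2w_1$ of $w$ satisfies $p\le c\,\frac{n}{\ln n}$.
   Context: A finite word $u=u_1\cdots u_n$ is a palindrome if $u_1u_2\cdots u_n=u_nu_{n-1}\cdots u_1$; the empty word is a palindrome. A word $w$ of length $n$ is rich if it has exactly $n+1$ distinct palindromic factors (including the empty word). For a rich word $w$, its UPS-factorization (Unioccurrent Palindromic Suffix factorization) is the factorization $w=w_pw_{p-1}\cdots w_2w_1$ into non-empty palindromes $w_1,\dots,w_p$ such that, for each $i=1,\dots,p$, $w_i$ is the longest palindromic suffix of $w_pw_{p-1}\cdots w_i$; such a factorization exists for every rich word, and its palindromes $w_1,\dots,w_p$ are pairwise distinct. *)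

(* Defs.v *)
From mathcomp Require Import all_boot.

Set Implicit Arguments.
Unset Strict Implicit.
Unset Printing Implicit Defensive.

Local Open Scope nat_scope.

Definition palindrome (T : eqType) (u : seq T) : bool := u == rev u.

(* Listed with repetitions; [mem_factors] identifies membership with [infix]. *)
Definition factors (T : eqType) (w : seq T) : seq (seq T) :=
  [seq take k (drop i w) | i <- iota 0 (size w).+1, k <- iota 0 (size w).+1].

Definition pal_factors (T : eqType) (w : seq T) : seq (seq T) :=
  undup [seq u <- factors w | palindrome u].

Definition rich (T : eqType) (w : seq T) : bool :=
  size (pal_factors w) == (size w).+1.

Definition longest_pal_suffix (T : eqType) (u v : seq T) : Prop :=
  [/\ suffix u v, palindrome u &
      forall x : seq T, suffix x v -> palindrome x -> size x <= size u].

(* [s] lists the blocks from left to right, [:: w_p; ...; w_1], so that the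
   prefix of [w] ending with the block at index [i] is [flatten (take i.+1 s)]
   and [size s] is p. *)
Definition UPS_factorization (T : eqType) (w : seq T) (s : seq (seq T)) : Prop :=
  [/\ flatten s = w,
      all (fun u => u != [::]) s &
      forall i, i < size s ->
        longest_pal_suffix (nth [::] s i) (flatten (take i.+1 s))].

Lemma mem_factors (T : eqType) (u w : seq T) : (u \in factors w) = infix u w.
Proof.
apply/allpairsP/infixP => [[[i k] /= [_ _ ->]]|[p [r ->]]].
  by exists (take i w), (drop k (drop i w)); rewrite !cat_take_drop.
exists (size p, size u); split; rewrite ?mem_iota ?add0n ?ltnS ?size_cat.
- by rewrite /= leq_addr.
- by rewrite /= addnCA leq_addr.
- by rewrite /= drop_size_cat ?take_size_cat.
Qed.

Lemma mem_pal_factors (T : eqType) (u w : seq T) :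
  (u \in pal_factors w) = infix u w && palindrome u.
Proof. by rewrite mem_undup mem_filter mem_factors andbC. Qed.

Lemma longest_pal_suffix_exists (T : eqType) (w : seq T) :
  w != [::] -> exists2 u : seq T, u != [::] & longest_pal_suffix u w.
Proof.
elim/last_ind: w => // w a _ _; set v := rcons w a.
pose P k := (k <= size v) && palindrome (drop (size v - k) v).
have P1 : P 1.
  by rewrite /P /v size_rcons subSS subn0 -cats1 drop_size_cat // /palindrome eqxx.
have Pb k : P k -> k <= size v by case/andP.
case: (ex_maxnP (ex_intro P 1 P1) Pb) => k /andP[kv pk] kmax.
have szk : size (drop (size v - k) v) = k by rewrite size_drop subKn.
exists (drop (size v - k) v).
  by rewrite -size_eq0 szk -lt0n; apply: kmax.
split=> //; first exact: suffix_drop.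
move=> x sx px; rewrite szk; apply: kmax.
rewrite /P (size_suffix sx) /=.
by move: sx; rewrite suffixE => /eqP ->.
Qed.

Lemma longest_pal_suffix_unique (T : eqType) (u u' v : seq T) :
  longest_pal_suffix u v -> longest_pal_suffix u' v -> u = u'.
Proof.
move=> [su pu mu] [su' pu' mu'].
have e : size u = size u' by apply/eqP; rewrite eqn_leq mu' // mu //.
by move: su su'; rewrite !suffixE e => /eqP du /eqP du'; rewrite -du du'.
Qed.

Lemma UPS_factorization_rcons (T : eqType) (w u : seq T) (s : seq (seq T)) :
  UPS_factorization w (rcons s u) <->
  exists v, [/\ w = v ++ u, u != [::], longest_pal_suffix u w &
                UPS_factorization v s].
Proof.
split=> [[fw ne lp]|[v [-> une lu [fv ne lp]]]].
  exists (flatten s); move: ne; rewrite all_rcons => /andP[une sne].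
  split=> //; first by rewrite -fw flatten_rcons.
    have := lp (size s); rewrite size_rcons nth_rcons ltnn eqxx.
    by rewrite take_oversize ?size_rcons // fw; apply.
  split=> // i ilt; have := lp i; rewrite size_rcons nth_rcons ilt -cats1.
  by rewrite takel_cat //; apply; apply: ltnW.
split; first by rewrite flatten_rcons fv.
  by rewrite all_rcons une.
move=> i; rewrite size_rcons ltnS nth_rcons leq_eqVlt => /orP[/eqP ->|ilt].
  by rewrite ltnn eqxx take_oversize ?size_rcons // flatten_rcons fv.
by rewrite ilt -cats1 takel_cat //; apply: lp.
Qed.

Lemma UPS_factorization_exists (T : eqType) (w : seq T) :
  exists s, UPS_factorization w s.
Proof.
have [n] := ubnP (size w); elim: n w => // n IH w; rewrite ltnS => wn.
have [->|/longest_pal_suffix_exists[u une lu]] := eqVneq w [::].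
  by exists [::].
have [/suffixP[v ev] _ _] := lu.
have [|s hs] := IH v.
  apply: leq_trans wn; rewrite ev size_cat -[ltnLHS]addn0 ltn_add2l.
  by rewrite lt0n size_eq0.
by exists (rcons s u); apply/UPS_factorization_rcons; exists v.
Qed.

Lemma UPS_factorization_unique (T : eqType) (w : seq T) (s s' : seq (seq T)) :
  UPS_factorization w s -> UPS_factorization w s' -> s = s'.
Proof.
elim/last_ind: s w s' => [|s u IH] w s'.
  case=> /= <- _ _; case/lastP: s' => // s' u'.
  case/UPS_factorization_rcons => v [] /esym/(congr1 size)/eqP.
  by rewrite size_cat addn_eq0 !size_eq0 => /andP[_ ->].
case/UPS_factorization_rcons => v [ev une lu hs].
case/lastP: s' => [[/= we _ _]|s' u'].
  move: ev; rewrite -we => /esym/(congr1 size)/eqP.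
  by rewrite size_cat addn_eq0 !size_eq0 (negPf une) andbF.
case/UPS_factorization_rcons => v' [ev' _ lu' hs'].
have uu := longest_pal_suffix_unique lu lu'; rewrite -{}uu in ev' *.
have /eqP := ev; rewrite ev' eqseq_cat; last first.
  by apply: (@addIn (size u)); rewrite -!size_cat -ev -ev'.
by move=> /andP[/eqP vv _]; rewrite vv in hs'; rewrite (IH _ _ hs hs').
Qed.

(* Main.v *)
Require Import Defs.
From mathcomp Require Import all_boot all_order all_algebra.
From mathcomp Require Import all_classical all_reals all_analysis.
From mathcomp Require Import zify.

(** In a rich word each new letter creates a new palindrome, which can only be
    the longest palindromic suffix. So each block of the UPS-factorization is
    not a factor of what precedes it, and the blocks are pairwise distinct.
    Fewer than [q ^ k] of them are shorter than [k], and the others number at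
    most [n / k]; take [k] about half of the base-[q] logarithm of [n]. *)

Set Implicit Arguments.
Unset Strict Implicit.
Unset Printing Implicit Defensive.

Import Order.TTheory GRing.Theory Num.Theory.

Local Open Scope ring_scope.

Lemma infix_rcons_or (T : eqType) (p x r v : seq T) (a : T) :
  rcons v a = p ++ x ++ r -> r = [::] \/ infix x v.
Proof.
case/lastP: r => [|r b]; first by left.
rewrite -!rcons_cat => /rcons_inj[-> _]; right; exact: infix_infix.
Qed.

Lemma suffix_le (T : eqType) (x u w : seq T) :
  suffix u w -> suffix x w -> (size x <= size u)%N -> suffix x u.
Proof.
case/suffixP => p ->; rewrite !suffixE size_cat => /eqP ex le_xu.
by rewrite -addnBA // drop_cat ltnNge leq_addr /= addKn in ex; rewrite ex.
Qed.

Lemma pal_factors_rcons (T : eqType) (v u : seq T) (a : T) :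
  longest_pal_suffix u (rcons v a) ->
  {subset pal_factors (rcons v a) <= u :: pal_factors v}.
Proof.
case=> su pu mu x; rewrite inE !mem_pal_factors => /andP[/infixP[p [r e]] px].
rewrite px andbT; have [r0|->] := infix_rcons_or e; last by rewrite orbT.
have sx : suffix x (rcons v a) by rewrite e r0 cats0 suffix_suffix.
(* A palindromic suffix of the palindrome u is also a prefix of u. *)
have : prefix x u.
  by rewrite -suffix_rev -(eqP px) -(eqP pu) (suffix_le su sx) ?mu.
case/suffixP: su => p' e' /prefixP[t eu]; rewrite eu in e' *.
(* If [t] is empty, [x] is [u]; otherwise the copy of [x] at the front of [u] ends before the last
   letter, hence lies in [v]. *)
by have [->|->] := infix_rcons_or e'; rewrite ?cats0 ?eqxx ?orbT.
Qed.

Lemma size_pal_factors_rcons (T : eqType) (v : seq T) (a : T) :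
  (size (pal_factors (rcons v a)) <= (size (pal_factors v)).+1)%N.
Proof.
have [|u _ /pal_factors_rcons sub] := @longest_pal_suffix_exists _ (rcons v a).
  by rewrite -size_eq0 size_rcons.
exact: uniq_leq_size (undup_uniq _) sub.
Qed.

Lemma size_pal_factors (T : eqType) (v : seq T) :
  (size (pal_factors v) <= (size v).+1)%N.
Proof.
elim/last_ind: v => [|v a IH]; first by rewrite (leq_trans (size_undup _)).
by rewrite size_rcons (leq_trans (size_pal_factors_rcons v a)).
Qed.

(** Appending a letter adds at most one palindrome, so the maximal count for [rcons v a] forces the
    maximal count for [v]. *)
Lemma rich_rcons (T : eqType) (v : seq T) (a : T) : rich (rcons v a) -> rich v.
Proof.
rewrite /rich size_rcons => /eqP ra.
by rewrite eqn_leq size_pal_factors -ltnS -ra size_pal_factors_rcons.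
Qed.

Lemma rich_catl (T : eqType) (v t : seq T) : rich (v ++ t) -> rich v.
Proof.
by elim/last_ind: t => [|t a IH]; rewrite ?cats0 // -rcons_cat => /rich_rcons.
Qed.

(** If [u] already occurred in [v], appending [a] would create no palindrome, leaving at most
    [(size v).+1] of them, one too few for richness. *)
Lemma rich_longest_pal_suffix_new (T : eqType) (v u : seq T) (a : T) :
  rich (rcons v a) -> longest_pal_suffix u (rcons v a) -> ~~ infix u v.
Proof.
move=> ra lu; apply/negP => iu; have [_ pu _] := lu.
have sub : {subset pal_factors (rcons v a) <= pal_factors v}.
  move=> x /(pal_factors_rcons lu); rewrite inE => /predU1P[->|//].
  by rewrite mem_pal_factors iu.
have := uniq_leq_size (undup_uniq _) sub.
by rewrite (eqP ra) size_rcons leqNgt ltnS size_pal_factors.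
Qed.

Lemma infix_flatten (T : eqType) (u : seq T) (s : seq (seq T)) :
  u \in s -> infix u (flatten s).
Proof.
case/splitPr => s1 s2; rewrite flatten_cat.
by apply/infixP; exists (flatten s1), (flatten s2).
Qed.

Lemma UPS_factorization_uniq (T : eqType) (w : seq T) (s : seq (seq T)) :
  rich w -> UPS_factorization w s -> uniq s.
Proof.
elim/last_ind: s w => [//|s u IH] w rw.
case/UPS_factorization_rcons => v [ew une lu hs].
rewrite rcons_uniq (IH v) ?andbT //; last by move: rw; rewrite ew => /rich_catl.
(* The last block first occurs when its final letter [a] is appended, whereas every block of [s]
   already occurs in [v]. *)
case/lastP: u une ew lu => // u a _; rewrite -rcons_cat => ew lu.
rewrite {}ew in rw lu; apply: contra (rich_longest_pal_suffix_new rw lu).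
case: hs => <- _ _ /infix_flatten iu.
exact: infix_prefix_trans iu (prefix_prefix _ _).
Qed.

(** The strict bound carries the induction: with [q = #|A|], [1 + q * size W < q * (size W).+1]
    because [q >= 2]. *)
Lemma short_words (A : finType) (k : nat) : (2 <= #|A|)%N ->
  exists2 W : seq (seq A), (size W < #|A| ^ k)%N &
    forall x : seq A, (size x < k)%N -> x \in W.
Proof.
move=> hq; elim: k => [|k [W sW inW]]; first by exists [::].
exists ([::] :: [seq a :: x | a <- enum A, x <- W]).
  rewrite /= size_allpairs -cardE expnS (leq_trans _ (leq_mul (leqnn _) sW)) //.
  by rewrite mulnS -addn2 addnC leq_add2r.
case=> [|a x] //= sx; rewrite inE; apply/allpairsP; exists (a, x).
by rewrite mem_enum inW.
Qed.

(** Split at length [k]: distinct shorter words number fewer than [#|A| ^ k], and each of the others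
    takes up at least [k] letters of [flatten s]. *)
Lemma uniq_size_flatten (A : finType) (s : seq (seq A)) (k : nat) :
  (2 <= #|A|)%N -> uniq s ->
  (k * size s <= k * #|A| ^ k + size (flatten s))%N.
Proof.
move=> hq us; rewrite -(count_predC (fun x => size x < k)%N s) mulnDr.
apply: leq_add.
  have [W sW inW] := short_words k hq.
  rewrite leq_mul2l -size_filter (leq_trans _ (ltnW sW)) ?orbT //.
  apply: uniq_leq_size; first exact: filter_uniq.
  by move=> x; rewrite mem_filter => /andP[/inW].
elim: s {us} => [|x s IH]; first by rewrite muln0.
rewrite /= size_cat mulnDr leq_add // -leqNgt.
by case: (leqP k) => le_kx; rewrite ?muln1 ?muln0.
Qed.

Theorem theorem1 (R : realType) (q : nat) (A : finType)
    (hq : (2 <= q)%N) (hA : #|A| = q) :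
  exists c : R, 1 < c /\
    forall w : seq A, rich w -> (2 <= size w)%N ->
    forall s : seq (seq A), UPS_factorization w s ->
      (size s)%:R <= c * ((size w)%:R / ln (size w)%:R).
Proof.
(* The factor [q.+1] comes from [kp] below, and [2 * q] from [lnn]. *)
exists (2 * q.+1 * q)%:R; split.
  by rewrite ltr1n -mulnA mul2n -addnn; case: q hq {hA} => [|[|q]].
move=> w rw w2 s ups; set n := size w.
(* Base [q ^ 2] gives [q ^ (2 * m) <= n < q ^ (2 * k)]: the lower bound serves [kq], the upper one
   [lnn]. *)
pose m := trunc_log (q ^ 2) n; pose k := m.+1.
have q0 : (0 < q)%N by apply: ltnW.
have qq1 : (1 < q ^ 2)%N by rewrite -[ltnLHS](exp1n 2) ltn_exp2r.
have n0 : (0 < n)%N by apply: ltnW.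
have kq : (k * q ^ k <= q * n)%N.
  rewrite expnS mulnCA leq_mul2l; apply/orP; right.
  (* Since [m < q ^ m], [k * q ^ m <= q ^ (2 * m) <= n]. *)
  apply: leq_trans (trunc_logP qq1 n0); rewrite -expnM mul2n -addnn.
  by rewrite expnD leq_mul2r ltn_expl ?orbT.
have kp : (k * size s <= q.+1 * n)%N.
  apply: (@leq_trans (k * q ^ k + n)); last by rewrite mulSn addnC leq_add2l.
  have := uniq_size_flatten k _ (UPS_factorization_uniq rw ups).
  by case: ups => -> _ _; rewrite hA; apply.
have lnn : ln n%:R <= (2 * k * q)%:R :> R.
  have q0R : 0 < q%:R :> R by rewrite ltr0n.
  apply: (@le_trans _ _ (ln ((q ^ (2 * k))%:R))).
    rewrite ler_ln ?posrE ?ltr0n ?expn_gt0 ?q0 // ler_nat expnM.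
    exact: ltnW (trunc_log_ltn _ qq1).
  (* The crude bound [ln q <= q] keeps the constant a natural number. *)
  rewrite natrX lnXn // -[leLHS]mulr_natl [leRHS]natrM ler_wpM2l //.
  exact: ltW (ln_sublinear q0R).
have ln0 : 0 < ln n%:R :> R by rewrite ln_gt0 // ltr1n.
rewrite mulrA ler_pdivlMr //.
apply: (@le_trans _ _ ((size s)%:R * (2 * k * q)%:R)).
  by rewrite ler_wpM2l.
rewrite -!natrM ler_nat.
have -> : (size s * (2 * k * q) = 2 * q * (k * size s))%N by lia.
have -> : (2 * q.+1 * q * n = 2 * q * (q.+1 * n))%N by lia.
by rewrite leq_mul2l kp orbT.
Qed.
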